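(* There exists an integer $n_0$ such that the following holds for every odd integer $n \geq n_0$. Let $G$ be an $n$-vertex graph. If, for some real number $\delta > 0$ (which may depend on $n$), the minimum degree of $G$ satisfies $\delta(G) \geq \delta n$, and $\kappa(G) \geq \max\{180\, \alpha(G), 2000\, \delta^{-2}\}$, then $\mathcal{C}_n(G) = \mathcal{C}(G)$.
   Context: Graphs are finite and simple. $\delta(G)$ is the minimum degree of $G$ (not to be confused with the real number $\delta$), $\kappa(G)$ is the vertex-connectivity of $G$ and $\alpha(G)$ is its independence number. The cycle space $\mathcal{C}(G)$ is the vector space over $\mathbb{F}_2$ spanned by the incidence vectors (in $\mathbb{F}_2^{E(G)}$) of the edge-sets of all cycles of $G$. If $G$ has $n$ vertices, $\mathcal{C}_n(G)$ is the subspace of $\mathcal{C}(G)$ spanned by the incidence vectors of the edge-sets of cycles of length $n$ in $G$, i.e. of Hamilton cycles of $G$. *)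

(* Defs.v *)
From mathcomp Require Import all_boot all_order all_algebra.
From mathcomp Require Import reals.
Set Implicit Arguments.
Unset Strict Implicit.
Unset Printing Implicit Defensive.

Import GRing.Theory.

Record sgraph := SGraph {
  vertex :> finType;
  adj : rel vertex;
  adj_sym : symmetric adj;
  adj_irrefl : irreflexive adj }.

Section GraphParameters.
Variable G : sgraph.

Definition degree (x : G) : nat := #|[set y | adj x y]|.

(* Every degree is smaller than #|G|, so the neutral element #|G| does not
   affect the minimum unless G is empty. *)
Definition min_degree : nat := \big[minn/#|G|]_(x : G) degree x.

Definition stable (S : {set G}) : bool :=
  [forall x in S, forall y in S, ~~ adj x y].

Definition independence_number : nat := \max_(S : {set G} | stable S) #|S|.

Definition induced_connected (A : {set G}) : bool :=
  [forall x in A, forall y in A,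
     connect [rel u v | [&& u \in A, v \in A & adj u v]] x y].

Definition k_connected (k : nat) : bool :=
  (k < #|G|) &&
  [forall X : {set G}, (#|X| < k) ==> induced_connected (~: X)].

(* The largest k for which G is k-connected; in particular it is n - 1 for
   the complete graph on n vertices. *)
Definition connectivity : nat := \max_(k < #|G| | k_connected k) k.

Definition edges : {set {set G}} :=
  [set [set p.1; p.2] | p : G * G & adj p.1 p.2].

Definition edge : finType := {e : {set G} | e \in edges}.

Definition edge_space := {ffun edge -> ('F_2)^o}.

Definition incidence (F : {set {set G}}) : edge_space :=
  [ffun e : edge => ((val e \in F)%:R)%R].

Definition cycle_edges (c : seq G) : {set {set G}} :=
  [set [set x; next c x] | x in c].

(* A cycle is identified with its edge-set; ucycleb only asks for a cyclic walk
   without repeated vertices, so the degenerate lengths 0, 1, 2 are excluded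
   explicitly. *)
Definition cycles_of_length (k : nat) : {set {set {set G}}} :=
  [set cycle_edges c | c : k.-tuple G & (2 < k) && ucycleb (@adj G) c].

(* A cycle has at most #|G| vertices. *)
Definition cycles : {set {set {set G}}} :=
  \bigcup_(k < #|G|.+1) cycles_of_length k.

Definition cycle_space : {vspace edge_space} :=
  <<[seq incidence F | F in cycles]>>%VS.

Definition cycle_space_of_length (k : nat) : {vspace edge_space} :=
  <<[seq incidence F | F in cycles_of_length k]>>%VS.

End GraphParameters.

(* Main.v *)
Require Import Defs.
From mathcomp Require Import all_boot all_order all_algebra.
From mathcomp Require Import reals zify.
Set Implicit Arguments.
Unset Strict Implicit.
Unset Printing Implicit Defensive.
Import Order.TTheory GRing.Theory Num.Theory.

(** Suppose that some cycle is not a sum of Hamilton cycles. By duality over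
F_2 ([separating_functional]) there is a 0/1 weight on the edges for which
every Hamilton cycle has even weight but some cycle has odd weight. Such a
weight is refuted by exhibiting a Hamilton cycle of odd weight.

Every closed walk carries a label in F_2 x F_2: the parity of its length and
its weight. The heart of the proof is that a simple cycle with label (0,1),
i.e. of even length and odd weight, that is short compared with the
connectivity, can be absorbed ([even_cycle_hamilton]). Write it as two internally
disjoint paths a x_1 .. x_m b and a y_1 .. y_m b, and link each x_i to y_i by a
short path P_i, all of them disjoint. There are two ways to zigzag from a to b,
each of which runs through every P_i: one starts along a x_1, the other along
a y_1. They have the same vertices, and between them they use each edge of the
cycle once and each P_i twice, so their weights differ. A path from b to a
through all remaining vertices closes both into Hamilton cycles,
one of which has odd weight. That path exists by the theorem of Chvatal and
Erdos ([hamilton_path]), as deleting few vertices leaves a graph whose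
connectivity exceeds its independence number.

It remains to find a short cycle with label (0,1). A graph of large minimum degree
has small diameter ([short_walk]), even after removing few
vertices, so every label taken by closed walks is a sum of labels of short
closed walks through a fixed root ([closed_through_root]). The given cycle
yields a short closed walk of odd weight. A Hamilton cycle has odd length,
because n is odd; if its weight is even, its label is (1,0), so some short
closed walk has label (1,0) or (0,1). One of these two walks or their
concatenation is a short closed walk with label (0,1).

To make it simple ([even_closed_simple]), split it at repeated vertices. Either
a shorter closed walk with label (0,1) appears, or two simple odd cycles
with labels (1,0) and (1,1) remain. In the latter case ([two_odd_cycles]), the cycles are
joined by two disjoint short paths, and the choice of an arc on each cycle
gives four closed walks that take all four labels.

With d the minimum degree, k the connectivity, Q = floor(2n/d) and L = 3Q, short paths
have at most L vertices as long as at most k/2 vertices are avoided. The even cycle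
has length at most 6L and the rungs of the ladder have at most 3 L^2 vertices,
which is affordable since k >= 500 Q^2 and k >= 180 alpha. *)

(** * Walks *)

Section Walks.
Variable G : sgraph.
Implicit Types (x y z u v a b : G) (p q r : seq G) (U : {set G}).

(** A walk is given by its start x and the sequence p of the vertices after x, so
that [size p] is its length and walks are composed by concatenation. A closed
walk of positive length lists x at the end of p, so that for a duplicate-free p
it is a simple cycle, or an edge run to and fro, which has even length and even
weight. *)
Definition walk x p y := path (@adj G) x p && (last x p == y).

Lemma walk_cat x y z p q : walk x p y -> walk y q z -> walk x (p ++ q) z.
Proof.
case/andP=> xp /eqP py /andP[yq qz].
by rewrite /walk cat_path last_cat py xp yq.
Qed.

Lemma walk_catE x z p q :
  walk x (p ++ q) z = walk x p (last x p) && walk (last x p) q z.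
Proof. by rewrite /walk cat_path last_cat eqxx andbT andbA. Qed.

Lemma walk_last x y p : walk x p y -> last x p = y.
Proof. by case/andP=> _ /eqP. Qed.

Definition walk_rev x p := rev (belast x p).

Lemma rev_walk_rev x p : rev (x :: p) = last x p :: walk_rev x p.
Proof. by rewrite lastI rev_rcons. Qed.

Lemma last_walk_rev x p : last (last x p) (walk_rev x p) = x.
Proof.
by have := congr1 (last x) (rev_walk_rev x p); rewrite rev_cons last_rcons /= => <-.
Qed.

Lemma walk_revP x y p : walk x p y -> walk y (walk_rev x p) x.
Proof.
case/andP=> xp /eqP <-; rewrite /walk /walk_rev rev_path.
rewrite (eq_path (e' := @adj G)) ?xp; last by move=> u v; rewrite adj_sym.
by rewrite last_walk_rev eqxx.
Qed.

Lemma size_walk_rev x p : size (walk_rev x p) = size p.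
Proof. by rewrite size_rev size_belast. Qed.

Lemma perm_walk_rev x p : perm_eq (last x p :: walk_rev x p) (x :: p).
Proof. by rewrite -rev_walk_rev perm_rev. Qed.

Lemma mem_split x p : x \in p -> exists p1 p2, p = p1 ++ x :: p2.
Proof. by case/splitPr=> p1 p2; exists p1, p2. Qed.

Lemma last_split x y p :
  y \in x :: p -> exists p1 p2, p = p1 ++ p2 /\ last x p1 = y.
Proof. by case/splitPl=> p1 p2 <-; exists p1, p2. Qed.

Lemma connect_ind (e : rel G) (S : pred G) x y :
  (forall u v, e u v -> S u -> S v) -> connect e x y -> S x -> S y.
Proof.
move=> He /connectP[p + ->]; elim: p x => //= z p IH x /andP[xz zp] Sx.
exact: IH zp (He _ _ xz Sx).
Qed.

Lemma k_connectedP k U x y :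
  k_connected G k -> #|U| < k -> x \notin U -> y \notin U ->
  connect [rel u v | [&& u \in ~: U, v \in ~: U & adj u v]] x y.
Proof.
case/andP=> _ /forallP/(_ U)/implyP H ltU xU yU.
move/forallP: (H ltU) => /(_ x); rewrite inE xU => /forallP/(_ y).
by rewrite inE yU.
Qed.

Lemma connect_walk U x y :
  connect [rel u v | [&& u \in ~: U, v \in ~: U & adj u v]] x y ->
  x \notin U ->
  exists p, [/\ walk x p y, uniq (x :: p) & {in x :: p, forall z, z \notin U}].
Proof.
case/connectP=> p0 /shortenP[p xp Up _] -> {p0} xU.
exists p; split=> //.
  by rewrite /walk eqxx andbT; apply: sub_path xp => u v /= /and3P[].
move=> z; rewrite inE => /predU1P[-> //|].
elim: p x xp {Up xU} => //= y' p IH x /andP[/and3P[_ H _] yp].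
by rewrite inE => /predU1P[->|]; [rewrite inE in H | exact: IH yp].
Qed.

(** * Hamilton paths: the theorem of Chvatal and Erdos *)

Section Hamilton.
Variables (k : nat) (U : {set G}) (a b : G).
Hypothesis Gk : k_connected G k.
Hypothesis Uk : #|U| + independence_number G < k.
Hypothesis ab : a != b.

(** Let H be the component, outside the path and U, of the missed vertex h, and N
its set of neighbours on the path. If a path vertex and its successor are both
in N, or if the successors v, v' of two vertices of N are adjacent, then the
path can be rerouted through H. Otherwise h and the successors of N form a stable set, so N
is too small for the union of N and U to separate h from the rest of the path. *)
Lemma hamilton_extend p h :
  walk a p b -> uniq (a :: p) -> {in a :: p, forall z, z \notin U} ->
  h \notin U -> h \notin a :: p ->
  exists p', [/\ walk a p' b, uniq (a :: p'),
    {in a :: p', forall z, z \notin U} & size p < size p'].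
Proof.
move=> wp Up pU hU hp.
set X := [set z | (z \in a :: p) || (z \in U)].
pose e := [rel u v | [&& u \in ~: X, v \in ~: X & adj u v]].
pose H := [set z | connect e h z].
have hX : h \notin X by rewrite inE negb_or hp.
have HX z : z \in H -> z \notin X.
  rewrite inE => hz; apply: (connect_ind (S := fun z => z \notin X)) hz hX.
  by move=> u v /and3P[_]; rewrite inE.
have esym : connect_sym e.
  by apply: sym_connect_sym => u v /=; rewrite adj_sym andbCA.
pose N := [set u in a :: p | [exists y in H, adj u y]].
have Nq u v : u \in N -> v \in N ->
    exists q, [/\ walk u (rcons q v) v, 0 < size q, uniq q & {subset q <= H}].
  rewrite !inE => /andP[_ /existsP[x /andP[xH ux]]].
  move=> /andP[_ /existsP[y /andP[yH vy]]].
  have xy : connect e x y.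
    rewrite !inE in xH yH.
    by apply: connect_trans yH; rewrite esym.
  case: (connect_walk xy (HX _ xH)) => q [wq Uq qX].
  exists (x :: q); split=> //.
    move: wq => /andP[wq /eqP lq].
    by rewrite /walk /= ux rcons_path last_rcons eqxx wq lq adj_sym vy.
  move=> z zq; rewrite inE; move: xH; rewrite inE => xH.
  apply: (connect_trans xH).
  have : connect e x z.
    case/splitPl: zq wq qX => q1 q2 lq; rewrite walk_catE => /andP[wq1 _] qX.
    apply/connectP; exists q1; last by [].
    have {wq1} : path (@adj G) x q1 by case/andP: wq1.
    have {qX} : {in x :: q1, forall z, z \notin X}.
      by move=> t tq; apply: qX; move: tq; rewrite !inE mem_cat => /orP[->|->]; rewrite ?orbT.
    elim: (q1) (x) => //= t s IH x1 sX /andP[-> ts].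
    rewrite !inE -!(in_set (fun z => (z \in a :: p) || (z \in U))) -/X.
    have := sX x1; rewrite !inE eqxx /= => ->//.
    have := sX t; rewrite !inE eqxx orbT /= => ->//=.
    by apply: IH => // t' t's; apply: sX; rewrite inE t's orbT.
  by [].
(* Any rearrangement of p together with a nonempty q in H is a longer path. *)
have newpath p' q : q != [::] -> uniq q -> {subset q <= H} ->
   walk a p' b -> perm_eq p' (q ++ p) ->
   exists p', [/\ walk a p' b, uniq (a :: p'),
    {in a :: p', forall z, z \notin U} & size p < size p'].
  move=> q0 Uq qH wp' pp; exists p'.
  have perma : perm_eq (a :: p') (q ++ a :: p).
    by rewrite perm_sym (perm_catCA q [:: a] p) /= perm_cons perm_sym.
  split=> //.
  - rewrite (perm_uniq perma) cat_uniq Uq Up andbT.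
    apply/hasPn => z zp; apply/negP => /qH/HX; by rewrite inE zp.
  - move=> z; rewrite (perm_mem perma) mem_cat => /orP[/qH/HX|/pU //].
    by rewrite inE negb_or => /andP[].
  - by rewrite (perm_size pp) size_cat; case: (q) q0 => //= *; lia.
(* Two consecutive vertices of N: insert a path through H between them. *)
have insertion s1 v s2 : p = s1 ++ v :: s2 -> last a s1 \in N -> v \in N ->
   exists p', [/\ walk a p' b, uniq (a :: p'),
    {in a :: p', forall z, z \notin U} & size p < size p'].
  move=> Ep uN vN; case: (Nq _ _ uN vN) => q [wq q0 Uq qH].
  apply: (newpath (s1 ++ rcons q v ++ s2) q) => //; first by case: (q) q0.
  - move: wp; rewrite Ep walk_catE => /andP[w1 /andP[/= /andP[_ w2] lb]].
    apply: walk_cat w1 _; apply: walk_cat wq _; by rewrite /walk w2.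
  - by rewrite Ep cat_rcons perm_catCA.
(* The predecessor of v on the path. *)
pose pr v := last a (take (index v p) p).
have prE s1 v s2 : p = s1 ++ v :: s2 -> pr v = last a s1.
  move=> Ep; rewrite /pr Ep.
  suff -> : index v (s1 ++ v :: s2) = size s1 by rewrite take_size_cat.
  rewrite index_cat /= eqxx addn0; case: ifP => // vs1.
  by move: Up; rewrite Ep /= cat_uniq /= vs1 /= !andbF.
pose S0 := [set v in p | pr v \in N].
pose S := h |: S0.
have [stS|] := boolP (stable S); last first.
  rewrite negb_forall => /existsP[x]; rewrite negb_imply => /andP[xS].
  rewrite negb_forall => /existsP[y]; rewrite negb_imply negbK => /andP[yS xy].
  have hcase y' : y' \in S0 -> adj h y' ->
     exists p', [/\ walk a p' b, uniq (a :: p'),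
      {in a :: p', forall z, z \notin U} & size p < size p'].
    rewrite inE => /andP[yp prN] hy.
    have [s1 [s2 Ep]] := mem_split yp.
    apply: (insertion _ _ _ Ep); first by rewrite -(prE _ _ _ Ep).
    rewrite inE Ep inE mem_cat inE eqxx !orbT /=.
    by apply/existsP; exists h; rewrite inE connect0 adj_sym.
  move: xS yS; rewrite !in_setU1.
  case/predU1P=> [xh|xS0] /predU1P[yh|yS0].
  - by move: xy; rewrite xh yh adj_irrefl.
  - by apply: (hcase y) => //; rewrite -xh.
  - by apply: (hcase x) => //; rewrite -yh adj_sym.
  (* Adjacent x', y' whose predecessors u, u' are in N, in the order
     u x' .. u' y': go from u through H to u', back to x', then on to y'. *)
  have main x' y' s1 s2 : p = s1 ++ x' :: s2 -> pr x' \in N -> pr y' \in N ->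
     adj x' y' -> y' \in s2 ->
     exists p', [/\ walk a p' b, uniq (a :: p'),
      {in a :: p', forall z, z \notin U} & size p < size p'].
    move=> Ep prx pry xy' ys2.
    case/splitPr: s2 / ys2 Ep => t1 t2 Ep.
    have Epy : p = (s1 ++ x' :: t1) ++ y' :: t2 by rewrite Ep -catA.
    rewrite (prE _ _ _ Ep) in prx.
    rewrite (prE _ _ _ Epy) last_cat /= in pry.
    case: (Nq _ _ prx pry) => q [wq q0 Uq qH].
    apply: (newpath (s1 ++ rcons q (last x' t1) ++ walk_rev x' t1 ++ y' :: t2) q)=> //.
    + by case: (q) q0.
    + move: wp; rewrite Ep walk_catE => /andP[w1 /andP[/= /andP[_]]].
      rewrite cat_path last_cat /= => /and3P[w2 _ w3] lb.
      apply: walk_cat w1 _; apply: walk_cat wq _.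
      apply: (walk_cat (y := x')); first by apply: walk_revP; rewrite /walk w2 /=.
      by rewrite /walk /= xy' w3.
    + rewrite Ep perm_sym (perm_catCA q s1) perm_cat2l cat_rcons perm_cat2l.
      rewrite -cat_cons -[_ :: t1 ++ _]cat_cons perm_cat2r.
      by rewrite perm_sym perm_walk_rev.
  move: xS0; rewrite inE => /andP[xp prx]; move: yS0; rewrite inE => /andP[yp pry].
  have [s1 [s2 Ep]] := mem_split xp.
  move: (yp); rewrite {1}Ep mem_cat inE => /or3P[ys1|/eqP yx|ys2].
  - case/splitPr: s1 / ys1 Ep => t1 t2 Ep.
    apply: (main y x t1 (t2 ++ x :: s2)) => //; first by rewrite Ep -catA.
      by rewrite adj_sym.
    by rewrite mem_cat inE eqxx orbT.
  - by move: xy; rewrite yx adj_irrefl.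
  - exact: (main x y s1 s2).
have leS : #|S| <= independence_number G.
  by rewrite /independence_number (bigop.bigmax_sup S).
have hS0 : h \notin S0.
  by rewrite inE; move: hp; rewrite inE negb_or => /andP[_ /negPf->].
have NS : #|N| <= #|S|.
  rewrite cardsU1 hS0 (cardsD1 b N) leq_add ?leq_b1 //.
  apply: leq_trans (leq_imset_card pr S0); apply: subset_leq_card.
  apply/subsetP => u; rewrite !inE => /andP[ub /andP[up uy]].
  have [p1 [p2 [Ep lu]]] := last_split up.
  case: p2 Ep => [|v p2] Ep.
    by move: (walk_last wp); rewrite Ep cats0 lu => Eb; rewrite Eb eqxx in ub.
  apply/imsetP; exists v; last by rewrite (prE _ _ _ Ep) lu.
  rewrite inE {1}Ep mem_cat inE eqxx orbT /= (prE _ _ _ Ep) lu.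
  by rewrite inE uy andbT -{1}lu Ep -cat_cons mem_cat mem_last.
(* N is too small to separate h from the path, so the path cannot avoid N. *)
have NUk : #|N :|: U| < k.
  apply: leq_ltn_trans Uk; rewrite (leq_trans (leq_card_setU _ _)) //.
  by rewrite addnC leq_add2l (leq_trans NS).
have [|] := boolP ((a \in N) && (head b p \in N)).
  case/andP=> aN hN.
  have [v [p1 Ep]] : exists v p1, p = v :: p1.
    by case: (p) wp => [|v p1]; [rewrite /walk /= (negPf ab)|exists v, p1].
  by apply: (insertion [::] v p1) => //; rewrite Ep in hN.
move=> anot.
have [z zp zN] : exists2 z, z \in a :: p & z \notin N.
  move: anot; rewrite negb_and => /orP[aN|hN]; first by exists a; rewrite ?mem_head.
  exists (head b p) => //; case: (p) wp => [|v p1] /=; last by rewrite !inE eqxx orbT.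
  by rewrite /walk /= (negPf ab).
have zNU : z \notin N :|: U by rewrite inE negb_or zN pU.
have hNU : h \notin N :|: U.
  by rewrite inE negb_or hU andbT; rewrite inE negb_and hp.
have hz := k_connectedP Gk NUk hNU zNU.
have zH : z \in H.
  apply: (connect_ind (S := mem H)) hz _; last by rewrite /= inE connect0.
  move=> u v /= /and3P[_]; rewrite inE => vNU uv uH.
  have uX : u \notin X by apply: HX.
  have hu : connect e h u by move: (uH); rewrite /= inE.
  rewrite /= inE; apply: (connect_trans hu (connect1 _)) => /=.
  rewrite uv !in_setC uX andbT /=; apply: contra vNU.
  rewrite inE => /orP[vp|vU]; last by rewrite inE vU orbT.
  rewrite !inE -in_cons vp /=; apply/orP; left; apply/existsP; exists u.
  by rewrite inE hu adj_sym.
by have := HX _ zH; rewrite inE zp.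
Qed.

(** A longest path from a to b outside U misses no vertex outside U, by
[hamilton_extend]. *)
Lemma hamilton_path : a \notin U -> b \notin U ->
  exists p, [/\ walk a p b, uniq (a :: p) & forall z, (z \in a :: p) = (z \notin U)].
Proof.
move=> aU bU.
have Uk' : #|U| < k by apply: leq_ltn_trans Uk; rewrite leq_addr.
case: (connect_walk (k_connectedP Gk Uk' aU bU) aU) => p [].
have [m] := ubnP (#|G| - size p).
elim: m p => // m IH p ltm wp Up pU.
have [/forallP H|] := boolP [forall z, (z \in U) || (z \in a :: p)].
  exists p; split=> // z; apply/idP/idP => [/pU //|].
  by have /orP[->|] := H z.
rewrite negb_forall => /existsP[h]; rewrite negb_or => /andP[hU hp].
case: (hamilton_extend wp Up pU hU hp) => p' [wp' Up' pU' lt].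
apply: (IH p') => //.
have le : size (a :: p') <= #|G| by rewrite -(card_uniqP Up') max_card.
rewrite -ltnS; apply: leq_trans ltm; rewrite ltnS.
by apply: ltn_sub2l => //; apply: ltn_trans le.
Qed.

End Hamilton.
End Walks.

(** * Short paths in dense graphs *)

Lemma overlapping_sets (T : finType) (m e : nat) (A : 'I_m -> {set T}) :
  (forall i, e <= #|A i|) -> #|T| < m * e ->
  exists (i j : 'I_m) (z : T), [/\ i < j, z \in A i & z \in A j].
Proof.
move=> eA lt.
have [/existsP[i /existsP[j /existsP[z /and3P[*]]]]|H] :=
  boolP [exists i : 'I_m, exists j : 'I_m, exists z : T, [&& i < j, z \in A i & z \in A j]].
  by exists i, j, z.
case/negP: (negbT (ltn_geF lt)).
apply: (@leq_trans (\sum_i #|A i|)).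
  by rewrite -{1}(card_ord m) -sum_nat_const leq_sum.
under eq_bigr => i _ do rewrite -sum1_card big_mkcond /=.
rewrite exchange_big /= -sum1_card leq_sum // => z _.
rewrite -big_mkcond sum1_card; apply/card_le1_eqP => i j zi zj.
have noij i' j' : z \in A i' -> z \in A j' -> ~~ (i' < j').
  move=> zi' zj'; apply: contra H => lt'.
  by apply/existsP; exists i'; apply/existsP; exists j'; apply/existsP; exists z;
    rewrite lt' zi'.
by apply/val_inj/eqP; rewrite eqn_leq leqNgt noij //= leqNgt noij.
Qed.

Section Short.
Variable G : sgraph.
Implicit Types (x y z u v a b : G) (p q r : seq G) (U : {set G}).

(** On a shortest path avoiding U, vertices at distance at least 3 along the path
have no common neighbour outside U, so every third vertex contributes e new
vertices. Hence the path has at most 3Q vertices when fewer than (Q+1)e vertices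
are available. *)
Lemma short_walk k e Q U x y :
  k_connected G k -> #|U| < k -> (forall v, #|U| + e <= degree v) ->
  #|G| < Q.+1 * e -> x \notin U -> y \notin U ->
  exists p, [/\ walk x p y, uniq (x :: p), {in x :: p, forall z, z \notin U}
              & size (x :: p) <= 3 * Q].
Proof.
move=> Gk Uk dU ltQ xU yU.
suff [p [wp pU sp]] : exists p, [/\ walk x p y,
    {in x :: p, forall z, z \notin U} & size (x :: p) <= 3 * Q].
  case/andP: wp => wp /eqP; case/shortenP: wp => q wq Uq qp lq.
  exists q; split=> //; first by rewrite /walk wq lq eqxx.
    move=> z; rewrite inE => /predU1P[->|/qp zp]; apply: pU; rewrite ?mem_head //.
    by rewrite inE zp orbT.
  apply: leq_trans sp; rewrite /= ltnS; apply: uniq_leq_size qp.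
  by case/andP: Uq.
case: (connect_walk (k_connectedP Gk Uk xU yU) xU) => p [wp _ pU].
elim/ltn_ind: (size p) {-2}p (erefl (size p)) wp pU => m IH {}p Em wp pU.
have [lep|ltp] := leqP (size (x :: p)) (3 * Q); first by exists p.
pose A (i : 'I_Q.+1) := [set z | adj (nth x (x :: p) (3 * i)) z] :\: U.
have eA i : e <= #|A i|.
  rewrite /A cardsD -(addKn #|U| e).
  apply: (leq_trans (leq_sub2r _ (dU (nth x (x :: p) (3 * i))))).
  by apply: leq_sub2l; apply: subset_leq_card; apply: subsetIr.
case: (overlapping_sets eA ltQ) => i [j [z [lij]]].
rewrite !inE => /andP[zU zi] /andP[_ zj].
(* The common neighbour z replaces a segment of length at least 3 by one of
   length 2. *)
have wcut h : h <= size p -> walk x (take h p) (nth x (x :: p) h) /\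
    walk (nth x (x :: p) h) (drop h p) y.
  move=> hp; move: wp; rewrite -{1}(cat_take_drop h p) walk_catE.
  suff -> : last x (take h p) = nth x (x :: p) h by case/andP.
  rewrite -nth_last size_takel //; case: h hp => [|h] hp; first by rewrite take0.
  by rewrite /= nth_take //; apply: set_nth_default.
have lej : 3 * j <= size p by move: ltp (ltn_ord j) => /=; lia.
have lei : 3 * i <= size p by lia.
have [w1 _] := wcut _ lei; have [_ w2] := wcut _ lej.
apply: (IH _ _ (take (3 * i) p ++ [:: z, nth x (x :: p) (3 * j) & drop (3 * j) p])
  erefl).
- rewrite -Em size_cat size_takel //= size_drop; lia.
- apply: walk_cat w1 _; case/andP: w2 => w2 l2.
  by rewrite /walk /= zi adj_sym zj w2.
- move=> t; rewrite inE mem_cat !inE => /or4P[/eqP->//|tp|/eqP->//|].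
    by apply: pU; rewrite inE (mem_take tp) orbT.
  case/predU1P=> [->|tp]; apply: pU; first by rewrite mem_nth.
  by rewrite inE (mem_drop tp) orbT.
Qed.

Lemma min_degree_le x : min_degree G <= degree x.
Proof.
rewrite /min_degree; have := mem_index_enum x; elim: (index_enum _) => //= y s IH.
by rewrite inE big_cons geq_min => /predU1P[<-|/IH ->]; rewrite ?leqnn ?orbT.
Qed.

Lemma degree_ltn x : degree x < #|G|.
Proof.
rewrite /degree -cardsT; apply: proper_card; rewrite properT.
apply/eqP => E; have := in_setT x; by rewrite -E inE adj_irrefl.
Qed.

Lemma k_connected_degree k x : k_connected G k -> k <= degree x.
Proof.
move=> Gk; rewrite leqNgt; apply/negP => ltd.
have ltk : k < #|G| by case/andP: Gk.
pose N := [set y | adj x y].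
have xN : x \notin N by rewrite inE adj_irrefl.
have [y yN] : exists y, y \notin x |: N.
  apply/existsP; rewrite -negb_forall; apply/negP => /forallP H.
  have : #|x |: N| < #|G|.
    by apply: leq_ltn_trans ltk; rewrite cardsU1 xN.
  by rewrite ltnNge => /negP; apply; rewrite -cardsT subset_leq_card //; apply/subsetP => z _.
move: yN; rewrite in_setU1 negb_or => /andP[yx yN].
case/negP: yx.
apply: (connect_ind (S := pred1 x) _ (k_connectedP Gk ltd xN yN)); last exact: eqxx.
move=> u v /= /and3P[_ vN uv] /eqP ux.
by move: vN; rewrite -ux !inE uv.
Qed.

Lemma k_connected_min_degree k : k_connected G k -> k <= min_degree G.
Proof.
move=> Gk; apply: (big_ind (fun m => k <= m)) => [|m1 m2 h1 h2|x _].
- by case/andP: Gk => /ltnW.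
- by rewrite leq_min h1.
- exact: k_connected_degree.
Qed.

Lemma connectivityP : 0 < connectivity G -> k_connected G (connectivity G).
Proof.
rewrite /connectivity; case: (pickP (fun k : 'I_#|G| => k_connected G k)) => [k Gk _|no].
  have c0 : 0 < #|[pred k : 'I_#|G| | k_connected G k]| by apply/card_gt0P; exists k.
  by case: (eq_bigmax_cond (fun k : 'I_#|G| => nat_of_ord k) c0) => k' k'P ->.
by rewrite big_pred0.
Qed.
End Short.

(** * Weights and ladders *)

Section Weights.
Variables (G : sgraph) (w : rel G).
Hypothesis wsym : symmetric w.
Implicit Types (x y z u v a b : G) (p q r : seq G) (U : {set G}).

Fixpoint weight x p := if p is y :: p' then w x y (+) weight y p' else false.

Lemma weight_cat x p q : weight x (p ++ q) = weight x p (+) weight (last x p) q.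
Proof. by elim: p x => //= y p IH x; rewrite IH addbA. Qed.

Lemma weight_rev x p : weight (last x p) (walk_rev x p) = weight x p.
Proof.
elim: p x => //= y p IH x; rewrite /walk_rev /= rev_cons -cats1 weight_cat IH.
rewrite (last_walk_rev y p) /= addbF addbC; congr (_ (+) _).
by rewrite wsym.
Qed.

(** This is all that the construction of an even cycle and of its ladder uses of
connectivity and minimum degree together: short links that avoid what has been
built so far. *)
Definition linked L B := forall U x y, #|U| <= B -> x \notin U -> y \notin U ->
  exists p, [/\ walk x p y, uniq (x :: p), {in x :: p, forall z, z \notin U}
              & size (x :: p) <= L].

Lemma card_seq p : #|[set z in p]| <= size p.
Proof. by rewrite cardsE card_size. Qed.

(** The two zigzags through a ladder with rails x xs b and y ys b. The rungs are
chosen one at a time, avoiding everything used so far (collected in U) and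
both remaining rails. A rung from x' to y' is crossed in opposite directions by
the two paths, so that they swap rails: the induction hypothesis is applied
with the roles of xs and ys exchanged. Rungs count twice in the total weight,
hence cancel. *)
Lemma ladder L B m x y xs ys b U :
  linked L B -> size xs = m -> size ys = m ->
  walk x (rcons xs b) b -> walk y (rcons ys b) b ->
  uniq (b :: xs ++ ys) -> {in b :: xs ++ ys, forall z, z \notin U} ->
  #|U| + m * L + 2 * m + 1 <= B ->
  exists p1 p2,
    [/\ walk x (rcons p1 b) b, walk y (rcons p2 b) b, uniq (b :: p1) & perm_eq p1 p2] /\
    [/\ {in p1, forall z, z \notin U}, size p1 <= m * L &
     weight x (rcons p1 b) (+) weight y (rcons p2 b) =
     weight x (rcons xs b) (+) weight y (rcons ys b)].
Proof.
move=> lk; elim: m x y xs ys U => [|m IH] x y [|x' xs] [|y' ys] U //=.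
  by move=> _ _ wx wy _ _ _; exists [::], [::].
move=> [sx] [sy] wx wy Uq qU leB.
pose X := U :|: [set z in b :: xs ++ ys].
have leX : #|X| <= B.
  apply: leq_trans (leq_card_setU _ _) _.
  apply: (@leq_trans (#|U| + (size xs + size ys).+1)); last by rewrite sx sy; lia.
  by rewrite leq_add2l (leq_trans (card_seq _)) //= size_cat.
have xX : x' \notin X.
  rewrite inE negb_or qU ?inE ?eqxx ?orbT //=.
  move: Uq; rewrite inE !mem_cat !inE !negb_or => /andP[/and3P[]].
  by rewrite eq_sym => -> _ _ /andP[/andP[-> /andP[_ ->]]].
have yX : y' \notin X.
  rewrite inE negb_or qU ?(inE, mem_cat) ?eqxx ?orbT //=.
  move: Uq; rewrite !inE !mem_cat !inE !negb_or cat_uniq /= !negb_or.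
  case/andP=> /and4P[_ _ by' _] /and4P[_ _ /andP[yxs _] /andP[yys _]].
  by rewrite eq_sym by' yxs yys.
have [r [wr Ur rX sr]] := lk X x' y' leX xX yX.
have rb : b \notin x' :: r.
  by apply/negP => /rX; rewrite !inE eqxx orbT.
pose U' := U :|: [set z in x' :: r].
have cU : #|U'| <= #|U| + L.
  apply: leq_trans (leq_card_setU _ _) _.
  by rewrite leq_add2l (leq_trans (card_seq _)).
have [] := IH y' x' ys xs U' sy sx.
- by move: wy; rewrite /walk /= => /andP[/andP[_ ->]].
- by move: wx; rewrite /walk /= => /andP[/andP[_ ->]].
- move: Uq; rewrite /= !mem_cat !inE !mem_cat !inE !negb_or !cat_uniq /= !negb_or.
  case/andP=> /and4P[_ -> _ ->] /and4P[_ -> /andP[_ H] /andP[_ ->]] /=.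
  by rewrite andbT has_sym.
- move=> z zq; rewrite inE negb_or; apply/andP; split.
    apply: qU; move: zq; rewrite !(inE, mem_cat) => /or3P[]->; by rewrite ?orbT.
  rewrite inE; apply/negP => /rX; rewrite !inE.
  by move: zq; rewrite inE !mem_cat => /or3P[]->; rewrite ?orbT.
- by move: leB cU; rewrite mulSn; lia.
move=> p1 [p2 [[w1 w2 Up1 p12] [pU sp1 wt]]].
have lr : last x' r = y' by apply: walk_last wr.
exists (x' :: r ++ p1), (y' :: walk_rev x' r ++ p2); split; split.
- rewrite -cat_cons rcons_cat; apply: walk_cat w1.
  move: wx; rewrite /walk /= => /andP[/andP[-> _] _] /=; exact: wr.
- rewrite -cat_cons rcons_cat; apply: walk_cat w2.
  move: wy; rewrite /walk /= => /andP[/andP[-> _] _] /=; exact: walk_revP wr.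
- have Pm : perm_eq (b :: (x' :: r) ++ p1) ((x' :: r) ++ b :: p1).
    by rewrite (perm_catCA [:: b] (x' :: r) p1).
  rewrite -[_ && _]/(uniq (b :: (x' :: r) ++ p1)) (perm_uniq Pm) cat_uniq Ur Up1 andbT.
  apply/hasPn => z; rewrite inE => /predU1P[->//|/pU]; rewrite inE negb_or.
  by case/andP=> _; rewrite inE.
- rewrite -!cat_cons; apply: perm_cat p12; rewrite perm_sym -lr.
  exact: perm_walk_rev.
- move=> z; rewrite -cat_cons mem_cat => /orP[|/pU]; last first.
    by rewrite inE negb_or => /andP[].
  move/rX; by rewrite inE negb_or => /andP[].
- by rewrite -cat_cons size_cat mulSn leq_add.
- rewrite /= !rcons_cat !weight_cat lr.
  have -> : weight y' (walk_rev x' r) = weight x' r by rewrite -lr weight_rev.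
  have -> : last y' (walk_rev x' r) = x' by rewrite -lr last_walk_rev.
  move: wt; move: (weight x' r) (weight x' (rcons p2 b)) (weight y' (rcons p1 b)).
  move: (weight x' (rcons xs b)) (weight y' (rcons ys b)) (w x x') (w y y').
  by do 7!case.
Qed.

End Weights.

(** * Short even cycles of odd weight *)

Section Cycles.
Variables (G : sgraph) (w : rel G).
Hypothesis wsym : symmetric w.
Implicit Types (x y z u v a b : G) (p q r : seq G) (U : {set G}).
Local Notation weight := (weight w).

(** The two zigzags of the ladder with rails the halves of c have the same vertices
and different weights. Closing both with the same path through
the remaining vertices gives two Hamilton cycles, one of odd weight. *)
Lemma even_cycle_hamilton L B k m a c :
  linked G L B -> k_connected G k -> m * L + independence_number G < k ->
  m * L + 2 * m + 2 <= B ->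
  walk a c a -> uniq c -> size c = (2 * m).+2 -> weight a c ->
  exists c', [/\ walk a c' a, uniq c', forall z, z \in c' & weight a c'].
Proof.
move=> lk Gk mk mB wc Uc sc ac.
have [xs [b [ys [Ec sx sy]]]] : exists xs b ys,
    [/\ c = xs ++ b :: rcons (rev ys) a, size xs = m & size ys = m].
  have sd : size (drop m c) = m.+2 by rewrite size_drop sc; lia.
  have lc : last a c = a by case/andP: wc => _ /eqP.
  move: lc; rewrite -{1}(cat_take_drop m c) last_cat.
  case Ed: (drop m c) sd => [|b q] //=.
  case/lastP: q Ed => [|q a'] Ed //= [sq]; rewrite last_rcons => Ea.
  exists (take m c), b, (rev q); split.
  - by rewrite revK -Ea -Ed cat_take_drop.
  - by rewrite size_takel // sc; lia.
  - by move: sq; rewrite size_rcons size_rev => -[].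
move: wc; rewrite Ec walk_catE => /andP[wx].
have -> : walk (last a xs) (b :: rcons (rev ys) a) a =
  adj (last a xs) b && walk b (rcons (rev ys) a) a by rewrite /walk /= andbA.
case/andP=> xb wy.
have wx' : walk a (rcons xs b) b.
  by rewrite -cats1; apply: walk_cat wx _; rewrite /walk /= xb eqxx.
have wy' : walk a (rcons ys b) b.
  by have := walk_revP wy; rewrite /walk_rev belast_rcons rev_cons revK.
have pc : perm_eq c (a :: b :: xs ++ ys).
  apply/permP => f; rewrite Ec -cats1 /= !count_cat /= !count_cat count_rev /=.
  by rewrite addn0 addnCA [RHS]addnCA; congr (_ + _); rewrite addnA addnC.
have := Uc; rewrite (perm_uniq pc) => /andP[aU Uq].
have qU : {in b :: xs ++ ys, forall z, z \notin [set a]}.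
  by move=> z zq; rewrite inE; apply: contra aU => /eqP<-.
have [] := ladder wsym lk sx sy wx' wy' Uq qU.
  by rewrite cards1; move: mB; clear; lia.
move=> p1 [p2 [[w1 w2 Up1 p12] [p1U sp1 wt]]].
have a1 : a \notin p1 by apply/negP => /p1U; rewrite inE eqxx.
have b1 : b \notin p1 by case/andP: Up1.
have ba : b != a by apply: contraNneq aU => ->; rewrite mem_head.
have [q [wq Uqq qE]] : exists q, [/\ walk b q a, uniq (b :: q) &
    forall z, (z \in b :: q) = (z \notin [set z in p1])].
  apply: (hamilton_path Gk) => //; rewrite ?inE //.
  by apply: leq_ltn_trans mk; rewrite leq_add2r (leq_trans (card_seq _)).
pose c1 := rcons p1 b ++ q; pose c2 := rcons p2 b ++ q.
have U1 : uniq c1.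
  have Up : uniq p1 by case/andP: Up1.
  rewrite /c1 cat_rcons cat_uniq Up Uqq andbT.
  by apply/hasPn => z; rewrite qE inE.
have p21 : perm_eq c1 c2 by rewrite perm_cat2r -!cats1 perm_cat2r.
have c1T z : z \in c1.
  by rewrite /c1 cat_rcons mem_cat qE inE orbN.
have : weight a c1 (+) weight a c2.
  rewrite /c1 /c2 !weight_cat !last_rcons addbACA addbb addbF wt.
  move: ac; rewrite Ec -cat_rcons weight_cat last_rcons => ac.
  have -> // : weight a (rcons ys b) = weight b (rcons (rev ys) a).
  by rewrite -(weight_rev wsym b) last_rcons /walk_rev belast_rcons rev_cons revK.
case E1: (weight a c1) => [] W2.
  by exists c1; split=> //; apply: walk_cat w1 wq.
exists c2; split=> //; first exact: walk_cat w2 wq.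
  by rewrite -(perm_uniq p21).
by move=> z; rewrite -(perm_mem p21).
Qed.

Lemma closed_rotate x y p : walk x p x -> y \in p ->
  exists p', [/\ walk y p' y, perm_eq p' p & weight y p' = weight x p].
Proof.
move=> wp yp; have [p1 [p2 [Ep ly]]] : exists p1 p2, p = p1 ++ p2 /\ last x p1 = y.
  by apply: last_split; rewrite inE yp orbT.
move: wp; rewrite Ep walk_catE ly => /andP[w1 w2].
exists (p2 ++ p1); split; first exact: walk_cat w2 w1.
  by rewrite perm_catC.
by rewrite !weight_cat ly (walk_last w2) addbC.
Qed.

Lemma not_uniq_split p : ~~ uniq p ->
  exists p1 u p2 p3, p = p1 ++ u :: p2 ++ u :: p3.
Proof.
elim: p => //= y p IH; rewrite negb_and negbK => /orP[/mem_split|/IH].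
  by case=> p1 [p2 ->]; exists [::], y, p1, p2.
by case=> p1 [u [p2 [p3 ->]]]; exists (y :: p1), u, p2, p3.
Qed.

Lemma closed_split x p : walk x p x -> ~~ uniq p ->
  exists u p1 p2, [/\ walk u p1 u, walk u p2 u, 0 < size p1 & 0 < size p2] /\
    size p1 + size p2 = size p /\ weight x p = weight u p1 (+) weight u p2.
Proof.
move=> wp /not_uniq_split[s1 [u [s2 [s3 Ep]]]].
have Ep' : p = rcons s1 u ++ rcons s2 u ++ s3 by rewrite Ep !cat_rcons.
move: wp; rewrite Ep' !walk_catE !last_rcons => /and3P[w1 w2 w3].
exists u, (rcons s2 u), (s3 ++ rcons s1 u); split; split => //.
- exact: walk_cat w3 w1.
- by rewrite size_rcons.
- by rewrite size_cat size_rcons addnS.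
- by rewrite !size_cat !size_rcons; lia.
- rewrite !weight_cat !last_rcons (walk_last w3).
  by rewrite addbC -addbA.
Qed.

(** The two arcs of a simple cycle between two of its vertices. *)
Lemma routes x p u v : walk x p x -> uniq p -> u \in p -> v \in p -> u != v ->
  exists q1 q2, [/\ walk u q1 v, walk u q2 v, uniq (u :: q1) & uniq (u :: q2)] /\
   [/\ {subset q1 <= p}, {subset q2 <= p}, 0 < size q1, 0 < size q2 &
    size q1 + size q2 = size p /\ weight u q1 (+) weight u q2 = weight x p].
Proof.
move=> wp Up up vp uv.
have [p' [wp' pp' <-]] := closed_rotate wp up.
have : v \in p' by rewrite (perm_mem pp').
move/mem_split => [s1 [s2 Ep]].
have Ep2 : p' = rcons s1 v ++ s2 by rewrite cat_rcons.
move: wp'; rewrite Ep2 walk_catE last_rcons => /andP[w1 w2].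
have Up' : uniq (s1 ++ v :: s2) by rewrite -Ep (perm_uniq pp').
have s2n : 0 < size s2.
  by case: (s2) w2 => // /andP[_ /= /eqP E]; rewrite E eqxx in uv.
have us2 : u \in s2.
  by rewrite -(walk_last w2); case: (s2) s2n => //= y s _; apply: mem_last.
have ls : last v s2 = u by apply: walk_last w2.
exists (rcons s1 v), (walk_rev v s2); split; split => //.
- exact: walk_revP w2.
- move: Up'; rewrite cat_uniq => /and3P[U1 H /andP[vs2 U2]].
  rewrite cons_uniq rcons_uniq U1 andbT mem_rcons inE negb_or uv /=.
  move/hasPn: H => H; rewrite (H u) ?inE ?us2 ?orbT //=.
  by apply: H; rewrite mem_head.
- rewrite -ls (perm_uniq (perm_walk_rev _ _)).
  by move: Up'; rewrite cat_uniq => /and3P[].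
- by move=> z zq; rewrite -(perm_mem pp') Ep2 mem_cat zq.
- move=> z zq; rewrite -(perm_mem pp') Ep mem_cat.
  by rewrite -(perm_mem (perm_walk_rev _ _)) inE zq !orbT.
- by rewrite size_rcons.
- by rewrite size_walk_rev.
- rewrite size_walk_rev -(perm_size pp') Ep2 size_cat; split=> //.
  have -> : weight u (walk_rev v s2) = weight v s2 by rewrite -ls weight_rev.
  by rewrite weight_cat last_rcons.
Qed.

(** Cutting a path from A to B after its last vertex in A and before its next vertex
in B makes it meet A and B only at its ends. *)
Lemma trim (A B : {set G}) x p y :
  walk x p y -> uniq (x :: p) -> x \in A -> y \in B ->
  exists u q v, [/\ walk u q v, uniq (u :: q), {subset u :: q <= x :: p} & size q <= size p] /\
   [/\ u \in A, v \in B, {in u :: q, forall z, z \in A -> z = u}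
     & {in u :: q, forall z, z \in B -> z = v}].
Proof.
elim/ltn_ind: (size p) {-2}p (erefl (size p)) x y => m IH {}p Em x y wp Up xA yB.
have [/hasP[z zp zA]|noA] := boolP (has (mem A) p).
  have [p1 [p2 Ep]] := mem_split zp.
  have ltm : size p2 < m by rewrite -Em Ep size_cat /=; lia.
  have wp2 : walk z p2 y.
    move: wp; rewrite Ep walk_catE => /andP[_]; rewrite /walk /=.
    by case/andP=> /andP[_ ->].
  have Up2 : uniq (z :: p2).
    by move: Up; rewrite Ep /= cat_uniq => /andP[_ /and3P[]].
  have [u [q [v [[? ? sub sq] H]]]] := IH _ ltm p2 erefl z y wp2 Up2 zA yB.
  exists u, q, v; split=> //; split=> //; last first.
    by apply: leq_trans sq _; rewrite ltnW // Em.
  by move=> t /sub tz; rewrite Ep inE mem_cat tz !orbT.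
have [/hasP[z zp /andP[/= zB zy]]|noB] := boolP (has [pred z | (z \in B) && (z != y)] (x :: p)).
  have [p1 [p2 [Ep lz]]] := last_split zp.
  have ltm : size p1 < m.
    rewrite -Em Ep size_cat; case: p2 Ep => [|t p2] Ep /=; last by lia.
    by move: zy; rewrite -lz -(walk_last wp) Ep cats0 eqxx.
  have wp1 : walk x p1 z.
    by move: wp; rewrite Ep walk_catE lz => /andP[].
  have Up1 : uniq (x :: p1).
    by move: Up; rewrite Ep -cat_cons cat_uniq => /and3P[].
  have [u [q [v [[? ? sub sq] H]]]] := IH _ ltm p1 erefl x z wp1 Up1 xA zB.
  exists u, q, v; split=> //; split=> //; last first.
    by apply: leq_trans sq _; rewrite ltnW // Em.
  by move=> t /sub tz; rewrite Ep -cat_cons mem_cat tz.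
exists x, p, y; do 2 split => //.
  move=> z; rewrite inE => /predU1P[//|zp] zA.
  by case/hasP: noA; exists z.
move=> z zp zB; apply/eqP; apply: contraNT noB => zy.
by apply/hasP; exists z => //=; rewrite zB.
Qed.

(** Switching arcs on c1 changes the label by (1, weight of c1), on c2 by (1, weight of c2);
these are the two vectors (1,0) and (1,1), a basis of F_2 x F_2, so the four
choices of arcs realize all four labels. The summand 2 accounts for the two
unused arcs. *)
Lemma choose_routes (x1 x2 u x y v : G) c1 c2 (e f : bool) :
  walk x1 c1 x1 -> uniq c1 -> odd (size c1) ->
  walk x2 c2 x2 -> uniq c2 -> odd (size c2) -> weight x1 c1 != weight x2 c2 ->
  u \in c1 -> x \in c1 -> u != x -> y \in c2 -> v \in c2 -> y != v ->
  exists p q, [/\ walk u p x, uniq (u :: p), {subset p <= c1} & 0 < size p] /\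
   [/\ walk y q v, uniq (y :: q), {subset q <= c2} & 0 < size q] /\
   [/\ size p + size q + 2 <= size c1 + size c2, odd (size p + size q) = e
     & weight u p (+) weight y q = f].
Proof.
move=> w1 U1 o1 w2 U2 o2 ne uc1 xc1 ux yc2 vc2 yv.
have [p [p' [[? ? ? ?] [? ? sp sp' [sc1 wc1]]]]] := routes w1 U1 uc1 xc1 ux.
have [q [q' [[? ? ? ?] [? ? sq sq' [sc2 wc2]]]]] := routes w2 U2 yc2 vc2 yv.
pose ok s t := (odd (size s + size t) == e) && (weight u s (+) weight y t == f).
have : [|| ok p q, ok p q', ok p' q | ok p' q'].
  move: o1 o2 ne; rewrite /ok -sc1 -sc2 -wc1 -wc2 !oddD.
  move: (odd _) (odd _) (odd _) (odd _) (weight u p) (weight u p') (weight y q)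
    (weight y q') => [] [] [] [] [] [] [] [] // _ _ _; by case: (e); case: (f).
by case/or4P=> /andP[/eqP oe /eqP wf]; [exists p, q|exists p, q'|exists p', q|exists p', q'];
  split=> //; split=> //; split=> //; clear -sc1 sc2 sp sp' sq sq'; lia.
Qed.

Lemma closed_odd_size x c : walk x c x -> odd (size c) -> uniq c -> forall u,
  exists2 y, y \in c & y != u.
Proof.
case: c => [|y [|z c]] //=.
  by rewrite /walk /= andbT => /andP[xy /eqP E]; rewrite E adj_irrefl in xy.
move=> _ _ /andP[yz _] u; have [E|] := eqVneq y u; last by exists y; rewrite ?mem_head.
exists z; first by rewrite !inE eqxx orbT.
by apply: contraNneq yz => ->; rewrite E mem_head.
Qed.

(** If the cycles share two vertices, arcs between them give a shorter closed walk
with label (0,1). Otherwise they are joined by a path R meeting each only at its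
ends (a single vertex if they intersect). R is short
and leaves a vertex on each cycle, so these can be linked by a second path that
avoids R altogether. The two paths and suitable arcs form a simple cycle. *)
Lemma two_odd_cycles L B x1 c1 x2 c2 :
  linked G L B -> L <= B ->
  walk x1 c1 x1 -> uniq c1 -> odd (size c1) ->
  walk x2 c2 x2 -> uniq c2 -> odd (size c2) -> weight x1 c1 != weight x2 c2 ->
  exists x c, [/\ walk x c x, ~~ odd (size c), weight x c &
   (size c < size c1 + size c2) || (uniq c && (size c <= size c1 + size c2 + 2 * L))].
Proof.
move=> lk LB w1 U1 o1 w2 U2 o2 ne.
have [/existsP[u /existsP[x /and4P[ux uc1 xc1 /andP[uc2 xc2]]]]|noshare] :=
  boolP [exists u : G, exists x : G, [&& u != x, u \in c1, x \in c1, u \in c2 & x \in c2]].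
  have xu : x != u by rewrite eq_sym.
  have [p [q [[wp _ _ _] [[wq _ _ _] [spq opq wpq]]]]] :=
    choose_routes false true w1 U1 o1 w2 U2 o2 ne uc1 xc1 ux xc2 uc2 xu.
  exists u, (p ++ q); split; first exact: walk_cat wp wq.
  - by rewrite size_cat opq.
  - by rewrite weight_cat (walk_last wp).
  - by rewrite size_cat; apply/orP; left; move: spq; clear; lia.
have share1 u x : u \in c1 -> x \in c1 -> u \in c2 -> x \in c2 -> u = x.
  move=> *; apply/eqP; apply: contraNT noshare => ux.
  by apply/existsP; exists u; apply/existsP; exists x; apply/and5P.
have [u [R [v [[wR UR sR uc1 vc2] [Rc1 Rc2 cc]]]]] : exists u R v,
   [/\ walk u R v, uniq (u :: R), size (u :: R) <= L, u \in c1 & v \in c2] /\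
   [/\ {in u :: R, forall z, z \in c1 -> z = u},
       {in u :: R, forall z, z \in c2 -> z = v} &
       forall z, z \in c1 -> z \in c2 -> z = u].
  have [/existsP[z /andP[z1 z2]]|disj] := boolP [exists z, (z \in c1) && (z \in c2)].
    exists z, [::], z; split; split=> //.
    - by rewrite /walk /= eqxx.
    - have [|||p [_ _ _ sp]] := lk set0 z z; rewrite ?inE ?cards0 //.
      exact: leq_trans sp.
    - by move=> t; rewrite inE => /eqP.
    - by move=> t; rewrite inE => /eqP.
    - by move=> t t1 t2; apply: share1.
  have [y1 y1c _] := closed_odd_size w1 o1 U1 x1.
  have [y2 y2c _] := closed_odd_size w2 o2 U2 x1.
  have [|||p [wp Up _ sp]] := lk set0 y1 y2; rewrite ?inE ?cards0 //.
  have [||u [R [v [[wR UR _ sR] [uA vB HA HB]]]]] :=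
    @trim [set z in c1] [set z in c2] _ _ _ wp Up; rewrite ?inE //.
  exists u, R, v; rewrite !inE in uA vB; split; split=> //.
  - exact: leq_trans sp.
  - by move=> z zR zc; apply: HA; rewrite ?inE.
  - by move=> z zR zc; apply: HB; rewrite ?inE.
  - move=> z z1 z2; case/negP: disj; apply/existsP; exists z; by rewrite z1.
pose U := [set z in u :: R].
have [x' x'c x'u] := closed_odd_size w1 o1 U1 u.
have [y' y'c y'v] := closed_odd_size w2 o2 U2 v.
have [|||r' [wr' Ur' r'U sr']] := lk U x' y'.
- by apply: leq_trans (card_seq _) (leq_trans sR LB).
- by rewrite inE; apply: contra x'u => /Rc1 ->.
- by rewrite inE; apply: contra y'v => /Rc2 ->.
have [||x [r [y [[wr Ur rsub sr] [xA yB rA rB]]]]] :=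
    @trim [set z in c1] [set z in c2] _ _ _ wr' Ur'; rewrite ?inE //.
rewrite !inE in xA yB.
have rU z : z \in x :: r -> z \notin u :: R by move=> /rsub/r'U; rewrite inE.
have vR : v \in u :: R by rewrite -(walk_last wR) mem_last.
have ux : u != x by apply/eqP => E; move: (rU x (mem_head _ _)); rewrite -E mem_head.
have yr : y \in x :: r by rewrite -(walk_last wr) mem_last.
have yv : y != v by apply/eqP => E; move: (rU y yr); rewrite E vR.
pose back := walk_rev u R.
have vback : v :: back = rev (u :: R) by rewrite rev_walk_rev (walk_last wR).
have bE z : z \in back -> z \in u :: R.
  by move=> zb; rewrite -mem_rev -vback inE zb orbT.
have Uback : uniq (v :: back) by rewrite vback rev_uniq.
have [p [q [[wp Up pc1 _] [[wq Uq qc2 _] [spq opq wpq]]]]] :=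
  choose_routes (odd (size r + size R)) (~~ (weight x r (+) weight v back))
   w1 U1 o1 w2 U2 o2 ne uc1 xA ux yB vc2 yv.
have wb : walk v back u by apply: walk_revP.
exists u, (p ++ r ++ q ++ back); split.
- exact: walk_cat wp (walk_cat wr (walk_cat wq wb)).
- move: opq; rewrite !size_cat size_walk_rev !oddD.
  move: (odd (size p)) (odd (size q)) (odd (size r)) (odd (size R)).
  by do 4!case.
- rewrite !weight_cat (walk_last wp) (walk_last wr) (walk_last wq).
  move: wpq; move: (weight _ p) (weight _ q) (weight _ r) (weight _ back).
  by do 4!case.
apply/orP; right; apply/andP; split; last first.
  rewrite !size_cat size_walk_rev; move: spq sr sr' sR => /=; clear; lia.
have cU (t : G) (s : seq G) : uniq (t :: s) -> t \notin s /\ uniq s by case/andP.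
have [up Up'] := cU _ _ Up; have [xr Ur2] := cU _ _ Ur.
have [yq Uq2] := cU _ _ Uq; have [vb Ub2] := cU _ _ Uback.
rewrite !cat_uniq !has_cat Up' Ur2 Uq2 Ub2 !negb_or /= !andbT.
apply/and3P; split; first (apply/and3P; split); first 3 last.
- apply/andP; split.
  + apply/hasPn => z zq; apply/negP => zr; move: yq; rewrite -(rB z) ?zq //.
      by rewrite inE zr orbT.
    by rewrite inE qc2.
  + apply/hasPn => z /bE zb; apply: contraL zb => zr; apply: rU.
    by rewrite inE zr orbT.
- apply/hasPn => z zb; apply/negP => zq; move: vb.
  by rewrite -(Rc2 z (bE _ zb) (qc2 _ zq)) zb.
- apply/hasPn => z zr; apply/negP => zp; move: xr.
  by rewrite -(rA z) ?zr // ?inE ?zr ?orbT ?pc1.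
- apply/hasPn => z zq; apply/negP => zp; move: up.
  by rewrite -(cc z (pc1 _ zp) (qc2 _ zq)) zp.
- apply/hasPn => z zb; apply/negP => zp; move: up.
  by rewrite -(Rc1 z (bE _ zb) (pc1 _ zp)) zp.
Qed.

(** Splitting an odd closed walk gives an odd and an even one. If the even one has
even weight, then the odd one is shorter and has the same label; otherwise the even
one is the first alternative. The base point of the walk may change. *)
Lemma odd_closed_simple (N : nat) x p :
  walk x p x -> size p < N -> odd (size p) ->
  (exists y c, [/\ walk y c y, size c < N, ~~ odd (size c) & weight y c]) \/
  exists y c, [/\ walk y c y, uniq c, odd (size c), weight y c = weight x p & size c <= size p].
Proof.
elim/ltn_ind: (size p) {-2}p (erefl (size p)) x => m IH {}p Em x wp lep op; subst m.
have [Up|nUp] := boolP (uniq p); first by right; exists x, p; split.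
have [u [p1 [p2 [[w1 w2 s1 s2] [sp wtp]]]]] := closed_split wp nUp.
wlog o1 : p1 p2 w1 w2 s1 s2 sp wtp / odd (size p1).
  move=> H; have [o1|e1] := boolP (odd (size p1)); first exact: (H p1 p2).
  apply: (H p2 p1) => //; first by rewrite addnC.
    by rewrite addbC.
  by move: op; rewrite -sp oddD (negPf e1).
have e2 : ~~ odd (size p2) by move: op; rewrite -sp oddD o1.
have lt1 : size p1 < size p by rewrite -sp -[X in X < _]addn0 ltn_add2l.
have lt2 : size p2 < size p by rewrite -sp -[X in X < _]add0n ltn_add2r.
have [wt2|wt2] := boolP (weight u p2).
  by left; exists u, p2; split=> //; apply: ltn_trans lep.
rewrite (negPf wt2) addbF in wtp.
have [|[y [c [? ? ? wc sc]]]] := IH _ lt1 p1 erefl u w1 (ltn_trans lt1 lep) o1.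
  by left.
right; exists y, c; split=> //; first by rewrite wc.
by apply: leq_trans sc _; rewrite ltnW.
Qed.

(** A shortest closed walk with label (0,1), if it is not simple, splits into two
odd closed walks with labels (1,0) and (1,1). These can be made simple by
[odd_closed_simple], and then [two_odd_cycles] applies. *)
Lemma even_closed_simple L B x p :
  linked G L B -> L <= B -> walk x p x -> ~~ odd (size p) -> weight x p ->
  exists y c, [/\ walk y c y, uniq c, ~~ odd (size c), weight y c & size c <= size p + 2 * L].
Proof.
move=> lk LB; elim/ltn_ind: (size p) {-2}p (erefl (size p)) x => m IH {}p Em x wp ep wt; subst m.
have shorter y c : walk y c y -> size c < size p -> ~~ odd (size c) -> weight y c ->
  exists y c, [/\ walk y c y, uniq c, ~~ odd (size c), weight y c & size c <= size p + 2 * L].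
  move=> wc lc ec wtc; have [z [d [? ? ? ? sd]]] := IH _ lc c erefl y wc ec wtc.
  by exists z, d; split=> //; apply: leq_trans sd _; rewrite leq_add2r ltnW.
have [Up|nUp] := boolP (uniq p).
  by exists x, p; split=> //; rewrite leq_addr.
have [u [p1 [p2 [[w1 w2 s1 s2] [sp wtp]]]]] := closed_split wp nUp.
have lt1 : size p1 < size p by rewrite -sp -[X in X < _]addn0 ltn_add2l.
have lt2 : size p2 < size p by rewrite -sp -[X in X < _]add0n ltn_add2r.
have o12 : odd (size p1) = odd (size p2).
  by move: ep; rewrite -sp oddD; do 2 case: (odd _).
rewrite wt in wtp.
have [o1|e1] := boolP (odd (size p1)); last first.
  have [t1|f1] := boolP (weight u p1); first exact: (shorter u p1).
  apply: (shorter u p2); rewrite -?o12 //.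
  by move: wtp; rewrite (negPf f1) /= => <-.
have o2 : odd (size p2) by rewrite -o12.
have [[y [c []]]|[y1 [c1 [wc1 U1 oc1 t1 sc1]]]] := odd_closed_simple w1 lt1 o1.
  exact: shorter.
have [[y [c []]]|[y2 [c2 [wc2 U2 oc2 t2 sc2]]]] := odd_closed_simple w2 lt2 o2.
  exact: shorter.
have ne : weight y1 c1 != weight y2 c2.
  by rewrite t1 t2; move: wtp; do 2 case: (weight _ _).
have sc : size c1 + size c2 <= size p by rewrite -sp leq_add.
have [y [c [wc ec tc /orP[lc|/andP[Uc lc]]]]] :=
  two_odd_cycles lk LB wc1 U1 oc1 wc2 U2 oc2 ne.
  by apply: (shorter y c) => //; apply: leq_trans sc.
exists y, c; split=> //; apply: leq_trans lc _.
by rewrite leq_add2r.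
Qed.

End Cycles.

(** * Closed walks through a root and Hamilton cycles of odd weight *)

Section Main.
Variable G : sgraph.
Implicit Types (x y z u v a b : G) (p q r : seq G) (U : {set G}).

(** If every closed walk r -> x -> y -> r through an edge xy has even weight, then
the weight of the chosen path from r is a potential: each edge weighs the
difference of its ends, so closed walks weigh 0. *)
Lemma closed_through_root (w : rel G) L (r x : G) p :
  symmetric w -> (forall v, exists t, walk r t v /\ size t < L) ->
  walk x p x -> weight w x p ->
  exists c, [/\ walk r c r, size c < 2 * L & weight w r c].
Proof.
move=> wsym /fin_all_exists[f fP] wp.
have [[]|//] : (exists c, [/\ walk r c r, size c < 2 * L & weight w r c]) \/
  weight w x p = weight w r (f x) (+) weight w r (f (last x p)); last first.
- by rewrite (walk_last wp) addbb => ->.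
- by move=> c cP _; exists c.
case/andP: wp => + _; elim: p x => [|y p IH] x /=; first by rewrite addbb; right.
case/andP=> xy /IH[|E]; first by left.
have [[wx sx] [wy sy]] := (fP x, fP y).
pose c := f x ++ y :: walk_rev r (f y).
have Ec : weight w r c = weight w r (f x) (+) (w x y (+) weight w r (f y)).
  rewrite weight_cat (walk_last wx) /=; congr (_ (+) (_ (+) _)).
  by rewrite -[RHS](weight_rev wsym) (walk_last wy).
have [tc|] := boolP (weight w r c).
  left; exists c; split=> //.
    apply: walk_cat wx _; have /andP[w1 w2] := walk_revP wy.
    by rewrite /walk /= xy w1.
  rewrite size_cat /= size_walk_rev; move: sx sy; clear; lia.
rewrite Ec E => H; right; move: H.
move: (weight w r (f (last y p))) (weight w r (f x)) (weight w r (f y)) (w x y).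
by do 4!case.
Qed.

(** Complementing the weight on all edges adds the parity of the length. This
applies [closed_through_root] to the sum of the two coordinates of the label. *)
Lemma weight_negb (w : rel G) x p :
  weight [rel u v | ~~ w u v] x p = odd (size p) (+) weight w x p.
Proof.
by elim: p x => //= y p IH x; rewrite IH; case: (odd _); case: (w _ _); case: (weight _ _ _).
Qed.

(** A Hamilton cycle has odd length here, so if its weight is even, its complementary
weight is odd. So there are short closed walks through a common root, one of odd weight and
one of odd complementary weight; one of them or their concatenation has
label (0,1). *)
Lemma hamilton_odd_weight (w : rel G) k L B x p :
  symmetric w -> k_connected G k -> linked G L B ->
  3 * L * L + independence_number G < k -> 3 * L * L + 6 * L + 2 <= B ->
  odd #|G| -> walk x p x -> weight w x p ->
  exists a c, [/\ walk a c a, uniq c, forall z, z \in c & weight w a c].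
Proof.
move=> wsym Gk lk kL BL oG wp tp.
have LB : L <= B by move: BL; clear; lia.
case: p wp tp => [//|y p] wp tp.
have xy : adj x y by case/andP: wp => /andP[].
have yx : y != x by apply: contraTneq xy => ->; rewrite adj_irrefl.
have [q [wq Uq qE]] : exists q, [/\ walk y q x, uniq (y :: q) &
    forall z, (z \in y :: q) = (z \notin set0)].
  apply: (hamilton_path Gk) => //; rewrite ?inE // cards0.
  by apply: leq_ltn_trans kL; rewrite leq_add2r.
have qT z : z \in y :: q by rewrite qE inE.
have wc : walk x (y :: q) x by move: wq; rewrite /walk /= xy.
have [tc|fc] := boolP (weight w x (y :: q)); first by exists x, (y :: q).
have oc : odd (size (y :: q)).
  rewrite -(card_uniqP Uq) (_ : #|_| = #|G|) //.
  by apply: eq_card => z; rewrite qT.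
have root v : exists t, walk x t v /\ size t < L.
  have [|||t [wt _ _ st]] := lk set0 x v; rewrite ?inE ?cards0 //.
  by exists t.
have [c1 [wc1 sc1 tc1]] := closed_through_root wsym root wp tp.
have [|||c2 [wc2 sc2 tc2]] :=
  @closed_through_root [rel u v | ~~ w u v] L x x (y :: q) _ root.
- by move=> u v /=; rewrite wsym.
- exact: wc.
- by rewrite weight_negb oc (negPf fc).
rewrite weight_negb in tc2.
have [C [wC sC eC tC]] : exists C, [/\ walk x C x, size C < 4 * L, ~~ odd (size C)
    & weight w x C].
  have [o1|e1] := boolP (odd (size c1)); last first.
    by exists c1; split=> //; apply: leq_trans sc1 _; rewrite leq_mul2r orbT.
  have [o2|e2] := boolP (odd (size c2)); last first.
    exists c2; split=> //; first by apply: leq_trans sc2 _; rewrite leq_mul2r orbT.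
    by move: tc2; rewrite (negPf e2).
  exists (c1 ++ c2); split; first exact: walk_cat wc1 wc2.
  - rewrite size_cat; move: sc1 sc2; clear; lia.
  - by rewrite size_cat oddD o1 o2.
  - rewrite weight_cat tc1 (walk_last wc1); by rewrite o2 in tc2.
have [a [c [wac Uc ec tca sc]]] := even_closed_simple wsym lk LB wC eC tC.
pose m := (size c)./2.-1.
have Em : size c = (2 * m).+2.
  rewrite /m; case: (c) tca ec => [//|? [//|? s]] _ /=; rewrite !negbK => es.
  by rewrite mul2n halfK (negPf es) subn0.
have mL : m < 3 * L by move: sc sC; rewrite Em; clear; lia.
have mLL : m * L <= 3 * L * L by rewrite leq_mul2r (ltnW mL) orbT.
have [||c' [? ? ? ?]] := even_cycle_hamilton wsym lk Gk _ _ wac Uc Em tca.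
- by apply: leq_ltn_trans kL; rewrite leq_add2r.
- apply: leq_trans BL; rewrite leq_add2r leq_add //.
  by move: mL; clear; lia.
by exists a, c'.
Qed.

(** Deleting k/2 <= d/2 vertices keeps the minimum degree at least d/2. *)
Lemma dense_linked k d : k_connected G k -> d = min_degree G -> 0 < k -> k <= d ->
  linked G (3 * ((2 * #|G|) %/ d)) k./2.
Proof.
move=> Gk Ed k0 kd U x y leU xU yU.
have d0 : 0 < d by apply: leq_trans kd.
apply: (short_walk (e := d - #|U|) Gk) => //.
- by move: leU k0; clear; lia.
- move=> v; rewrite subnKC Ed ?min_degree_le //.
  by rewrite -Ed; move: leU kd; clear; lia.
- have := ltn_ceil (2 * #|G|) d0.
  have dU : d <= 2 * (d - #|U|) by move: leU kd; clear; lia.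
  move=> H; rewrite -(ltn_pmul2l (isT : 0 < 2)); apply: leq_trans H _.
  by rewrite mulnCA leq_mul2l dU orbT.
Qed.

End Main.

(** * Edge weights as functionals on the edge space *)

(** The kernel of v - projv U v is exactly U. A coordinate of this endomorphism
serves as the functional. *)
Lemma separating_functional (F : fieldType) (vT : vectType F) (U : {vspace vT}) (u : vT) :
  u \notin U -> exists g : 'End(vT), g u != 0%R /\ forall v, v \in U -> g v = 0%R.
Proof.
move=> uU; exists (\1%VF - projv U)%R; rewrite add_lfunE opp_lfunE id_lfunE; split.
  by apply: contraNneq uU => /eqP; rewrite subr_eq0 => /eqP->; rewrite memv_proj.
by move=> v vU; rewrite add_lfunE opp_lfunE id_lfunE projv_id // subrr.
Qed.

Lemma F2_neq0D (a b : 'F_2) : ((a + b)%R != 0%R) = (a != 0%R) (+) (b != 0%R).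
Proof. by case: a => [[|[|[]]] //= ?]; case: b => [[|[|[]]] //= ?]. Qed.

Lemma sum_indicator (R : nzRingType) (I T : eqType) (h : I -> T) (s : seq I) (t : T) :
  uniq (map h s) -> (\sum_(i <- s) ((t == h i)%:R : R))%R = ((t \in map h s)%:R)%R.
Proof.
elim: s => [|i s IH] /=; first by rewrite big_nil.
case/andP=> his /IH E; rewrite big_cons E inE.
by have [->|_] := eqVneq t (h i); rewrite ?add0r //= (negPf his) addr0.
Qed.

Section CycleSpace.
Variable G : sgraph.
Implicit Types (x y z u v a b : G) (p q r c : seq G).

(** Equal edges at distinct vertices make these successors of each other, which
happens only on cycles of length at most 2. *)
Lemma next_edge_inj c : uniq c -> 2 < size c ->
  {in c &, injective (fun x => [set x; next c x])}.
Proof.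
move=> Uc sc x y xc yc /= E; have [//|xy] := eqVneq x y.
have : x \in [set y; next c y] by rewrite -E !inE eqxx.
have : y \in [set x; next c x] by rewrite E !inE eqxx.
rewrite !inE eq_sym (negPf xy) /= => /eqP yE /eqP xE.
case: (rot_to xc) => i s Es.
have Us : uniq (x :: s) by rewrite -Es rot_uniq.
have nE z : next c z = next (x :: s) z by rewrite -Es next_rot.
have: 2 < size (x :: s) by rewrite -Es size_rot.
rewrite nE in yE; rewrite nE in xE; case: s Us {Es nE} yE xE => [|a [|b s]] //=.
rewrite eqxx => /and3P[xa ab _] ->; rewrite !inE !negb_or in xa.
case/and3P: xa => xa xb _; rewrite [a == x]eq_sym (negPf xa) eqxx => xb'.
by rewrite xb' eqxx in xb.
Qed.

Lemma incidence_cycle c : uniq c -> 2 < size c ->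
  incidence (cycle_edges c) =
  (\sum_(x <- c) incidence [set [set x; next c x]])%R.
Proof.
move=> Uc sc; apply/ffunP => e; rewrite sum_ffunE ffunE.
under eq_bigr => x _ do rewrite ffunE inE.
have : uniq (map (fun x => [set x; next c x]) c).
  by rewrite map_inj_in_uniq //; apply: next_edge_inj.
have -> : (val e \in cycle_edges c) = (val e \in map (fun x => [set x; next c x]) c).
  by apply/imsetP/mapP => -[x xc ->]; exists x.
by move/sum_indicator->.
Qed.

Lemma weight_next (w : rel G) c x p : uniq c -> c = x :: p ->
  weight w x (rcons p x) = \big[addb/false]_(y <- c) w y (next c y).
Proof.
move=> Uc Ec; have : path (frel (next c)) x (rcons p x).
  by have := cycle_next Uc; rewrite {2}Ec.
suff E q : path (frel (next c)) x q ->
    weight w x q = \big[addb/false]_(y <- belast x q) w y (next c y).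
  by move/E->; rewrite belast_rcons -Ec.
elim: q x {Ec} => [|y q IH] x /=; first by rewrite big_nil.
by case/andP=> /eqP xy /IH->; rewrite big_cons xy.
Qed.

Section Functional.
Variables (g : 'End(edge_space G)) (e : edge G).
(** The edge weight dual to the functional sending v to coordinate e of g v. Pairs
that are not edges have weight 0, as their incidence vector vanishes. *)
Definition edge_rel : rel G := fun x y => (g (incidence [set [set x; y]])) e != 0%R.

Lemma edge_rel_sym : symmetric edge_rel.
Proof. by move=> x y; rewrite /edge_rel setUC. Qed.

Lemma functional_cycle c x p : uniq c -> 2 < size c -> c = x :: p ->
  (g (incidence (cycle_edges c)) e != 0%R) = weight edge_rel x (rcons p x).
Proof.
move=> Uc sc Ec; rewrite (weight_next _ Uc Ec) (incidence_cycle Uc sc) linear_sum sum_ffunE.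
by elim/big_rec2: _ => [|y b s _ <-]; rewrite ?eqxx // F2_neq0D.
Qed.
End Functional.

(** The walk from a ends at a, whereas the weight of the cyclic sequence c is read
from its first vertex; both run through the same edges. *)
Lemma cycle_of_walk a c : walk a c a -> uniq c -> 2 < size c ->
  cycle_edges c \in cycles_of_length G (size c) /\
  forall w : rel G, weight w a c = weight w (head a c) (rcons (behead c) (head a c)).
Proof.
case: c => [|b q] //= wc Uc sc; have /andP[/= /andP[ab bq] /eqP lq] := wc; split.
  apply/imsetP; exists (in_tuple (b :: q)) => //=.
    rewrite inE /= sc /ucycleb /= rcons_path bq lq ab; exact: Uc.
by move=> w; rewrite -cats1 weight_cat /= lq addbF addbC.
Qed.

Lemma cycle_space_hamilton k L B :
  k_connected G k -> linked G L B ->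
  3 * L * L + independence_number G < k -> 3 * L * L + 6 * L + 2 <= B ->
  odd #|G| -> cycle_space_of_length G #|G| = cycle_space G.
Proof.
move=> Gk lk kL BL oG; apply/eqP; rewrite eqEsubv; apply/andP; split.
  apply: sub_span => u /mapP[F]; rewrite mem_enum => FC ->.
  apply: map_f; rewrite mem_enum; apply/bigcupP; exists ord_max => //=.
apply/span_subvP => u /mapP[F]; rewrite mem_enum => /bigcupP[m _ /imsetP[c cP ->]] {F}.
move: cP; rewrite inE => /andP[m2 /andP[cyc Uc]] ->.
apply: contraT => /separating_functional[g [gu gU]].
have /existsP[e ge] : [exists e, g (incidence (cycle_edges c)) e != 0%R].
  rewrite -negb_forall; apply: contra gu => /forallP H.
  by apply/eqP/ffunP => e; rewrite ffunE; apply/eqP.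
have sc : 2 < size c by rewrite size_tuple.
move: (val c) sc cyc Uc ge => {gu m2 u c m} [|x p] // sc cyc Uc ge.
have [a [d [wd Ud dT td]]] :
  exists a d, [/\ walk a d a, uniq d, forall z, z \in d & weight (edge_rel g e) a d].
  apply: (@hamilton_odd_weight _ _ k L B x (rcons p x)) => //.
  - exact: edge_rel_sym.
  - by rewrite /walk last_rcons eqxx andbT.
  - by rewrite -(functional_cycle g e Uc sc).
have sd : size d = #|G|.
  by rewrite -(card_uniqP Ud); apply: eq_card => z; rewrite dT.
have d2 : 2 < size d.
  by rewrite sd; apply: leq_trans sc _; rewrite -(card_uniqP Uc) max_card.
have [dC dw] := cycle_of_walk wd Ud d2.
have Ed : d = head a d :: behead d by case: (d) d2.
have := functional_cycle g e Ud d2 Ed.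
rewrite -dw td gU ?ffunE ?eqxx //.
by apply: memv_span; apply: map_f; rewrite mem_enum -sd.
Qed.

End CycleSpace.

Local Open Scope ring_scope.

Theorem theorem1p4 (R : realType) :
  exists n0 : nat, forall n : nat, odd n -> (n0 <= n)%N ->
  forall G : sgraph, #|G| = n ->
  forall delta : R, 0 < delta ->
    delta * n%:R <= (min_degree G)%:R ->
    Num.max (180 * (independence_number G)%:R) (2000 * delta ^- 2)
      <= (connectivity G)%:R ->
    cycle_space_of_length G n = cycle_space G.
Proof.
exists 0 => n on _ G Gn delta d0 dn; rewrite ge_max => /andP[ka kd].
subst n.
set k := connectivity G in ka kd; set d := min_degree G in dn; set al := independence_number G in ka.
have ka' : (180 * al <= k)%N by rewrite -(ler_nat R) natrM.
have k0 : (0 < k)%N.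
  rewrite -(ltr_nat R); apply: lt_le_trans kd.
  by rewrite mulr_gt0 // ?ltr0n // invr_gt0 exprn_gt0.
have Gk := connectivityP k0; rewrite -/k in Gk.
have n0 : (0 < #|G|)%N by case: #|G| on.
have kled : (k <= d)%N by apply: k_connected_min_degree.
(* As delta <= d / n, the bound 2000 delta^-2 <= k clears to an inequality in nat. *)
have key : (2000 * #|G| ^ 2 <= k * d ^ 2)%N.
  rewrite -(ler_nat R) natrM natrX [X in _ <= X]natrM natrX.
  have h : 2000 <= k%:R * delta ^+ 2 :> R.
    by move: kd; rewrite ler_pdivrMr ?exprn_gt0.
  apply: (@le_trans _ _ (k%:R * delta ^+ 2 * #|G|%:R ^+ 2)).
    by rewrite ler_wpM2r // exprn_ge0.
  rewrite -mulrA ler_wpM2l // -exprMn lerXn2r ?nnegrE //.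
  by rewrite mulr_ge0 // ltW.
pose Q := ((2 * #|G|) %/ d)%N.
have dpos : (0 < d)%N by apply: leq_trans kled.
have Qk : (500 * Q ^ 2 <= k)%N.
  have h : (Q * d <= 2 * #|G|)%N by apply: leq_trunc_div.
  have h2 : (Q ^ 2 * d ^ 2 <= 4 * #|G| ^ 2)%N.
    by rewrite -expnMn -[4%N]/(2 ^ 2)%N -expnMn leq_exp2r.
  rewrite -(@leq_pmul2r (d ^ 2)) ?expn_gt0 ?dpos //.
  apply: leq_trans key; move: h2; clear; lia.
have Q2 : (2 <= Q)%N.
  rewrite leq_divRL // leq_mul2l /=.
  have /card_gt0P[x _] := n0.
  exact: leq_trans (min_degree_le x) (ltnW (degree_ltn x)).
have lk := dense_linked Gk (erefl d) k0 kled.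
rewrite -/Q in lk.
apply: (cycle_space_hamilton Gk lk) => //.
- rewrite -/al; move: Qk ka' Q2; clear; nia.
- move: Qk Q2; clear; nia.
Qed.
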